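(* Let $V$ be a vertex ring with Stone space $X$. Then $\pi:\mathcal{R}\to X$ (the map $v+\overline{M}\mapsto M$ from the disjoint union $\mathcal{R}=\bigsqcup_{M\in X}V/\overline{M}$, suitably topologized as described in the context) is an étale bundle of vertex rings.
   Context: A vertex ring is an additive abelian group $V$ with biadditive products $u(n)v$ for all $n\in\mathbf{Z}$ and a distinguished element $\mathbf{1}\in V$ (the vacuum) such that for all $u,v,w\in V$: (a) there is an integer $n_0(u,v)\ge 0$ with $u(n)v=0$ for all $n\ge n_0$; (b) $u(-1)\mathbf{1}=u$ and $u(n)\mathbf{1}=0$ for $n\ge 0$; (c) for all $r,s,t\in\mathbf{Z}$, $\sum_{i\ge 0}\binom{r}{i}(u(t+i)v)(r+s-i)w=\sum_{i\ge 0}(-1)^i\binom{t}{i}\{u(r+t-i)v(s+i)w-(-1)^t v(s+t-i)u(r+i)w\}$. Here $\binom{m}{n}=m(m-1)\cdots(m-n+1)/n!$ for $m\in\mathbf{Z}$, $n\ge 1$, and $\binom{m}{0}=1$. An idempotent of $V$ is $e\in V$ with $e(n)e=\delta_{n,-1}e$ for all $n\in\mathbf{Z}$. The set $B=B(V)$ of idempotents lies in the center $C(V)=\{u: u(n)=0\ \forall n\neq -1\}$, a commutative ring under $uv:=u(-1)v$, and $B$ is a Boolean ring with this multiplication and addition $e\oplus f:=e+f-2ef$. The Stone space of $V$ is $X=\mathrm{Spec}(B)$ (prime, equivalently maximal, ideals of $B$) with the Zariski topology; a basis is given by the sets $N(e)=\{M\in X: e\notin M\}$, $e\in B$. For $M\in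 X$ set $\overline{M}:=\bigcup_{e\in M}e(-1)V$, which is a 2-sided ideal of $V$ (a subgroup $I$ with $a(n)u,\ u(n)a\in I$ for $a\in V,u\in I,n\in\mathbf{Z}$), so $V/\overline{M}$ is a vertex ring. Let $\mathcal{R}$ be the disjoint union of the $V/\overline{M}$, $M\in X$, and $\pi(v+\overline{M})=M$. For $v\in V$ let $\sigma_v:X\to\mathcal{R}$, $\sigma_v(M)=v+\overline{M}$. $\mathcal{R}$ has the topology with basis the sets $\sigma_v(N(e))$, $v\in V$, $e\in B$. An étale bundle of vertex rings is a continuous surjection $p:E\to X$ that is a local homeomorphism ($E$ is covered by open sets mapped by $p$ homeomorphically onto open subsets of $X$), such that each stalk $E_x=p^{-1}(x)$ is a vertex ring, the maps $\Delta\to E$, $(t,u)\mapsto t-u$ and $(t,u)\mapsto t(n)u$ ($n\in\mathbf{Z}$) are continuous where $\Delta=\{(t,u)\in E\times E: p(t)=p(u)\}$ has the subspace topology, and the map $X\to E$ sending $x$ to the vacuum of $E_x$ is continuous. *)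

(* Defs.v *)
From HB Require Import structures.
From mathcomp Require Import all_boot all_order all_algebra.
From mathcomp Require Import generic_quotient ring_quotient zify ring.
From mathcomp Require Import all_classical topology.

Set Implicit Arguments.
Unset Strict Implicit.
Unset Printing Implicit Defensive.

Import Order.TTheory GRing.Theory Num.Theory.
Local Open Scope classical_set_scope.
Local Open Scope ring_scope.

(* The integer division is exact, see [binz_prod]. *)
Definition binz (m : int) (n : nat) : int :=
  ((\prod_(k < n) (m - k%:Z)) %/ n`!%:Z)%Z.

Lemma binz0 m : binz m 0 = 1.
Proof. by rewrite /binz big_ord0. Qed.

Lemma binz_exact m n (c : int) :
  \prod_(k < n) (m - k%:Z) = c * n`!%:Z -> binz m n = c.
Proof. by rewrite /binz => ->; rewrite mulzK // gt_eqF // ltz_nat fact_gt0. Qed.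

Lemma prod_posz (m n : nat) :
  \prod_(k < n) (m%:Z - k%:Z) = 'C(m, n)%:Z * n`!%:Z.
Proof.
rewrite -PoszM bin_ffact; elim: n => [|n IH]; first by rewrite big_ord0.
rewrite big_ord_recr /= IH ffactnSr.
case: (leqP n m) => [le_nm|lt_mn]; first by rewrite subzn.
by rewrite ffact_small ?mul0r.
Qed.

Lemma prod_negz (m n : nat) :
  \prod_(k < n) (Negz m - k%:Z) = (-1) ^+ n * 'C(m + n, n)%:Z * n`!%:Z.
Proof.
rewrite -mulrA -PoszM bin_ffact; elim: n => [|n IH].
  by rewrite big_ord0 mulr1.
rewrite big_ord_recr /= IH addnS ffactSS PoszM NegzE exprS.
by rewrite -addn1 !PoszD; ring.
Qed.

Lemma binz_nat (m n : nat) : binz m%:Z n = 'C(m, n)%:Z.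
Proof. exact: binz_exact (prod_posz m n). Qed.

Lemma binz_neg (m n : nat) : binz (Negz m) n = (-1) ^+ n * 'C(m + n, n)%:Z.
Proof. exact: binz_exact (prod_negz m n). Qed.

Lemma binz_prod m n : binz m n * n`!%:Z = \prod_(k < n) (m - k%:Z).
Proof. by case: m => m; rewrite (binz_nat, binz_neg) (prod_posz, prod_negz). Qed.

Lemma binz0S i : binz 0 i.+1 = 0.
Proof. by rewrite (binz_nat 0) bin0n. Qed.

Lemma binzN1 i : binz (-1) i = (-1) ^+ i.
Proof. by rewrite (binz_neg 0) add0n binn mulr1. Qed.

Lemma fsum_nat (A : zmodType) (N : nat) (F : nat -> A) :
  (forall i, (N <= i)%N -> F i = 0) ->
  \sum_(i \in [set: nat]) F i = \sum_(i < N) F i.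
Proof.
move=> F0; rewrite fsbig_ord; apply/esym/fsbig_widen => // i [_ /=].
by move=> /negP; rewrite -leqNgt => /F0.
Qed.

Lemma fsum1 (A : zmodType) (k : nat) (F : nat -> A) :
  (forall i, i != k -> F i = 0) -> \sum_(i \in [set: nat]) F i = F k.
Proof.
move=> F0; rewrite -(@fsbig_set1 _ 0 +%R _ k F); apply/esym/fsbig_widen => // i [_ /=].
by move=> /eqP /F0.
Qed.

Lemma fsum0 (A : zmodType) (F : nat -> A) :
  (forall i, F i = 0) -> \sum_(i \in [set: nat]) F i = 0.
Proof. by move=> F0; rewrite fsbig1. Qed.

Reserved Notation "u *_[ n ] v"
  (at level 40, n at level 99, left associativity, format "u  *_[ n ]  v").

(* [vmul n u v] is u(n)v.  The sums in [borcherds] are sums of finitely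
   supported families (by [vmul_trunc]). *)
HB.mixin Record Zmodule_isVertexRing V & GRing.Zmodule V := {
  vmul : int -> V -> V -> V;
  vac : V;
  vmulDl : forall n v, {morph (fun u => vmul n u v) : a b / a + b};
  vmulDr : forall n u, {morph (fun v => vmul n u v) : a b / a + b};
  vmul_trunc : forall u v, exists n0 : nat,
    forall n : int, n0%:Z <= n -> vmul n u v = 0;
  vmulv1 : forall u, vmul (-1) u vac = u;
  vmul_vac_ge0 : forall u (n : int), 0 <= n -> vmul n u vac = 0;
  borcherds : forall u v w (r s t : int),
    \sum_(i \in [set: nat])
      vmul (r + s - i%:Z) (vmul (t + i%:Z) u v) w *~ binz r i =
    \sum_(i \in [set: nat])
      (vmul (r + t - i%:Z) u (vmul (s + i%:Z) v w)
        - vmul (s + t - i%:Z) v (vmul (r + i%:Z) u w) *~ ((-1) ^ t))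
      *~ ((-1) ^+ i * binz t i)
}.

#[short(type="vertexRingType")]
HB.structure Definition VertexRing :=
  {V of GRing.Zmodule V & Zmodule_isVertexRing V}.

Notation "u *_[ n ] v" := (vmul n u v) : ring_scope.

Section VertexRingTheory.
Variable V : vertexRingType.
Implicit Types (u v w e f : V) (n r s t : int).

Lemma vmul0l n v : 0 *_[n] v = 0.
Proof. by apply: (addrI (0 *_[n] v)); rewrite -vmulDl !addr0. Qed.

Lemma vmul0r n u : u *_[n] 0 = 0.
Proof. by apply: (addrI (u *_[n] 0)); rewrite -vmulDr !addr0. Qed.

Lemma vmulNl n u v : (- u) *_[n] v = - (u *_[n] v).
Proof. by apply: (addrI (u *_[n] v)); rewrite -vmulDl !subrr vmul0l. Qed.

Lemma vmulNr n u v : u *_[n] (- v) = - (u *_[n] v).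
Proof. by apply: (addrI (u *_[n] v)); rewrite -vmulDr !subrr vmul0r. Qed.

Lemma vmulBl n u v w : (u - v) *_[n] w = u *_[n] w - v *_[n] w.
Proof. by rewrite vmulDl vmulNl. Qed.

Lemma vmulBr n u v w : u *_[n] (v - w) = u *_[n] v - u *_[n] w.
Proof. by rewrite vmulDr vmulNr. Qed.

Lemma vmul_comm u v : (forall i : nat, u *_[i%:Z] v = 0) ->
  forall r s w, u *_[r] (v *_[s] w) = v *_[s] (u *_[r] w).
Proof.
move=> uv0 r s w; have := borcherds u v w r s 0.
rewrite fsum0 => [|i]; last by rewrite add0r uv0 vmul0l mul0rz.
rewrite (fsum1 (k := 0)) => [|[|i] //]; last by rewrite binz0S mulr0 mulr0z.
rewrite binz0 mulr1 expr0z !mulr1z !addr0 => /esym/eqP.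
by rewrite subr_eq0 => /eqP.
Qed.

Lemma vac_comm u r s w : u *_[r] (vac *_[s] w) = vac *_[s] (u *_[r] w).
Proof. by apply: vmul_comm => i; rewrite vmul_vac_ge0. Qed.

(* The iterate formula for (u(-1)v)(s)w, when u(i)w = 0 for i >= 0 *)
Lemma vmulN1 u v w s : (forall i : nat, u *_[i%:Z] w = 0) ->
  (u *_[-1] v) *_[s] w =
  \sum_(i \in [set: nat]) u *_[-1 - i%:Z] (v *_[s + i%:Z] w).
Proof.
move=> uw0; have := borcherds u v w 0 s (-1).
rewrite (fsum1 (k := 0)) => [|[|i] //]; last by rewrite binz0S mulr0z.
rewrite binz0 mulr1z !addr0 add0r => ->.
apply: eq_fsbigr => i _; rewrite !add0r uw0 vmul0r mul0rz subr0.
by rewrite binzN1 -exprD addnn -mul2n exprM sqrrN !expr1n mulr1z.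
Qed.

Lemma idem_vac_step e (k : nat) :
  (forall i : nat, e *_[i%:Z] e = 0) -> e *_[-1] e = e ->
  (forall j : nat, (j < k)%N -> e *_[- j.+2%:Z] vac = 0) ->
  e *_[- k.+2%:Z] vac = e *_[- k.+2%:Z] e + e *_[- k.+2%:Z] e.
Proof.
move=> e0 e1 IH; rewrite -{1}e1 vmulN1 => [|i]; last by rewrite vmul_vac_ge0.
rewrite (fsum_nat (N := k.+2)) => [|i le_i]; last first.
  by rewrite [X in _ *_[_] X]vmul_vac_ge0 ?vmul0r //; lia.
rewrite big_ord_recl big_ord_recr /= big1 => [|i _]; last first.
  rewrite /bump /=; have lt_i := ltn_ord i.
  have -> : - k.+2%:Z + (1 + i)%:Z = - (k - i.+1).+2%:Z :> int by lia.
  by rewrite IH ?vmul0r //; lia.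
rewrite add0r addr0 subr0 (vmul_comm e0) vmulv1; congr (_ + _).
have -> : - k.+2%:Z + (bump 0 k)%:Z = - 1 :> int by rewrite /bump; lia.
have -> : - 1 - (bump 0 k)%:Z = - k.+2%:Z :> int by rewrite /bump; lia.
by rewrite vmulv1.
Qed.

Lemma int_neqN1P n : n != -1 ->
  (exists i : nat, n = i%:Z) \/ exists k : nat, n = - k.+2%:Z.
Proof.
case: n => [n|[|k]] // _; first by left; exists n.
by right; exists k; rewrite NegzE.
Qed.

Lemma vac_vac n : n != -1 -> (vac : V) *_[n] vac = 0.
Proof.
move=> /int_neqN1P [[i ->]|[k ->]]; first by rewrite vmul_vac_ge0.
elim/ltn_ind: k => k IH.
have vac0 (i : nat) : (vac : V) *_[i%:Z] vac = 0 by rewrite vmul_vac_ge0.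
have /eqP := idem_vac_step vac0 (vmulv1 _) IH.
by rewrite -subr_eq0 opprD addrA subrr add0r oppr_eq0 => /eqP.
Qed.

Lemma vac_vmul n v : n != -1 -> vac *_[n] v = 0.
Proof. by move=> nN1; rewrite -[v]vmulv1 -vac_comm vac_vac // vmul0r. Qed.

Lemma vmul1v v : vac *_[-1] v = v.
Proof. by rewrite -[v in LHS]vmulv1 -vac_comm !vmulv1. Qed.

Definition idempotent e : Prop :=
  forall n, e *_[n] e = if n == -1 then e else 0.

Definition center : set V := [set u | forall n, n != -1 -> forall v, u *_[n] v = 0].

Lemma vac_eq0_central e : (forall n, n != -1 -> e *_[n] vac = 0) -> center e.
Proof.
move=> e0.
have key r (j : nat) w : e *_[r - j.+1%:Z] w *~ binz r j.+1 = 0.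
  have := borcherds e vac w r 0 (- j.+2%:Z).
  rewrite (fsum1 (k := j.+1)) => [|i ne_ij]; last first.
    by rewrite e0 ?vmul0l ?mul0rz //; lia.
  have -> : - j.+2%:Z + j.+1%:Z = -1 :> int by lia.
  rewrite addr0 vmulv1 => ->; apply: fsum0 => i.
  rewrite [X in _ *_[_] X - _]vac_vmul; last by lia.
  rewrite vmul0r vac_vmul; last by lia.
  by rewrite mul0rz subr0 mul0rz.
move=> n /int_neqN1P [[m ->]|[k ->]] v; last first.
  have := key (-1) k v; rewrite binzN1.
  have -> : - 1 - k.+1%:Z = - k.+2%:Z :> int by lia.
  rewrite -signr_odd; case: (odd _) => /=; last by rewrite mulr1z.
  by rewrite mulrN1z => /eqP; rewrite oppr_eq0 => /eqP.
have binm l (j : nat) : (l <= m)%N ->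
    e *_[m%:Z] v *~ 'C(m + j.+1, m - l)%:Z = 0.
  elim: l j => [|l IH] j le_lm.
    have := key (m + j.+1)%:Z j v.
    have -> : (m + j.+1)%:Z - j.+1%:Z = m%:Z :> int by lia.
    have -> : 'C(m + j.+1, m - 0) = 'C(m + j.+1, j.+1).
      by rewrite subn0 -bin_sub ?leq_addr // addKn.
    by rewrite binz_nat.
  have := IH j.+1 (ltnW le_lm).
  have -> : (m - l = (m - l.+1).+1)%N by lia.
  rewrite addnS binS PoszD mulrzDr.
  have -> : ((m - l.+1).+1 = m - l)%N by lia.
  by rewrite IH ?add0r // ltnW.
by have := binm m 0%N (leqnn m); rewrite subnn bin0 mulr1z.
Qed.

Lemma idempotent_central e : idempotent e -> center e.
Proof.
move=> eI; apply: vac_eq0_central => n /int_neqN1P [[i ->]|[k ->]].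
  by rewrite vmul_vac_ge0.
elim/ltn_ind: k => k IH.
have e0 (i : nat) : e *_[i%:Z] e = 0 by rewrite eI.
by rewrite (idem_vac_step e0 _ IH) ?(eI (-1)) // eI addr0.
Qed.

Lemma centerD u v : center u -> center v -> center (u + v).
Proof. by move=> uC vC n nN1 w; rewrite vmulDl uC // vC // addr0. Qed.

Lemma centerN u : center u -> center (- u).
Proof. by move=> uC n nN1 w; rewrite vmulNl uC // oppr0. Qed.

Lemma center0 : center 0.
Proof. by move=> n _ w; rewrite vmul0l. Qed.

Lemma center1 : center vac.
Proof. by move=> n nN1 w; rewrite vac_vmul. Qed.

Lemma centerAC u r v w : center u ->
  v *_[r] (u *_[-1] w) = u *_[-1] (v *_[r] w).
Proof. by move=> uC; rewrite (@vmul_comm u) // => i; rewrite uC. Qed.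

Lemma centerA u v n w : center u ->
  (u *_[-1] v) *_[n] w = u *_[-1] (v *_[n] w).
Proof.
move=> uC; rewrite vmulN1 => [|i]; last by rewrite uC.
rewrite (fsum1 (k := 0)) ?subr0 ?addr0 // => i i0.
by rewrite uC //; lia.
Qed.

Lemma centerM u v : center u -> center v -> center (u *_[-1] v).
Proof. by move=> uC vC n nN1 w; rewrite centerA // vC // vmul0r. Qed.

Lemma centerC u v : center u -> u *_[-1] v = v *_[-1] u.
Proof. by move=> uC; rewrite -[u in RHS]vmulv1 centerAC // vmulv1. Qed.

Lemma idempotentE e : idempotent e <-> center e /\ e *_[-1] e = e.
Proof.
split=> [eI|[eC ee] n]; first by split; [exact: idempotent_central|exact: (eI (-1))].
by case: eqVneq => [->//|/eC].
Qed.

End VertexRingTheory.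

Arguments center V : clear implicits.

Record vcenter (V : vertexRingType) :=
  VCenter { vcenter_val :> V; vcenterP : `[< center V vcenter_val >] }.

HB.instance Definition _ V := [isSub for @vcenter_val V].
HB.instance Definition _ V := [Choice of vcenter V by <:].

Section CenterRing.
Variable V : vertexRingType.
Implicit Types a b c : vcenter V.

Lemma vcenter_center a : center V (val a).
Proof. exact/asboolP/vcenterP. Qed.

Definition vcenter_mk (u : V) (uC : center V u) : vcenter V :=
  VCenter (introT (asboolP _) uC).

Definition vcenter_zero := vcenter_mk (@center0 V).
Definition vcenter_one := vcenter_mk (@center1 V).
Definition vcenter_opp a := vcenter_mk (centerN (vcenter_center a)).
Definition vcenter_add a b :=
  vcenter_mk (centerD (vcenter_center a) (vcenter_center b)).
Definition vcenter_mul a b :=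
  vcenter_mk (centerM (vcenter_center a) (vcenter_center b)).

Lemma vcenter_addA : associative vcenter_add.
Proof. by move=> a b c; apply/val_inj/addrA. Qed.
Lemma vcenter_addC : commutative vcenter_add.
Proof. by move=> a b; apply/val_inj/addrC. Qed.
Lemma vcenter_add0 : left_id vcenter_zero vcenter_add.
Proof. by move=> a; apply/val_inj/add0r. Qed.
Lemma vcenter_addN : left_inverse vcenter_zero vcenter_opp vcenter_add.
Proof. by move=> a; apply/val_inj/addNr. Qed.
HB.instance Definition _ := GRing.isZmodule.Build (vcenter V)
  vcenter_addA vcenter_addC vcenter_add0 vcenter_addN.

Lemma vcenter_mulA : associative vcenter_mul.
Proof. by move=> a b c; apply/val_inj/esym/centerA/vcenter_center. Qed.
Lemma vcenter_mulC : commutative vcenter_mul.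
Proof. by move=> a b; apply/val_inj/centerC/vcenter_center. Qed.
Lemma vcenter_mul1 : left_id vcenter_one vcenter_mul.
Proof. by move=> a; apply/val_inj/vmul1v. Qed.
Lemma vcenter_mulDl : left_distributive vcenter_mul +%R.
Proof. by move=> a b c; apply/val_inj/vmulDl. Qed.
HB.instance Definition _ := GRing.Zmodule_isComPzRing.Build (vcenter V)
  vcenter_mulA vcenter_mulC vcenter_mul1 vcenter_mulDl.

End CenterRing.

Record boolring (V : vertexRingType) :=
  BoolRing { boolring_val :> V; boolringP : `[< idempotent boolring_val >] }.

HB.instance Definition _ V := [isSub for @boolring_val V].
HB.instance Definition _ V := [Choice of boolring V by <:].

Section BooleanRing.
Variable V : vertexRingType.
Implicit Types (e f g : boolring V) (a b c : vcenter V).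

Lemma boolring_idem e : idempotent (val e).
Proof. exact/asboolP/boolringP. Qed.

Lemma boolring_center e : center V (val e).
Proof. exact/idempotent_central/boolring_idem. Qed.

Definition boolring_vcenter e : vcenter V := vcenter_mk (boolring_center e).
Local Notation "%C e" := (boolring_vcenter e) (at level 5, e at level 5).

Lemma boolring_sq e : %C e * %C e = %C e.
Proof. exact/val_inj/(boolring_idem e (-1)). Qed.

Lemma boolring_vcenter_inj : injective boolring_vcenter.
Proof. by move=> e f /(congr1 val) /= ef; exact: val_inj. Qed.

Lemma vcenter_sq_idem a : a * a = a -> idempotent (val a).
Proof.
move=> /(congr1 val) /= aa; apply/idempotentE; split=> //.
exact: vcenter_center.
Qed.

Definition boolring_mk (u : V) (uI : idempotent u) : boolring V :=
  BoolRing (introT (asboolP _) uI).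

Lemma boolring0_subproof : idempotent (0 : V).
Proof. by move=> n; rewrite vmul0l if_same. Qed.

Lemma boolring1_subproof : idempotent (vac : V).
Proof. exact: (@vcenter_sq_idem 1 (mulr1 _)). Qed.

Lemma boolringM_subproof e f : idempotent (val e *_[-1] val f).
Proof.
by apply: (@vcenter_sq_idem (%C e * %C f)); rewrite mulrACA !boolring_sq.
Qed.

Lemma boolringD_subproof e f :
  idempotent (val e + val f - (val e *_[-1] val f) *+ 2).
Proof.
apply: (@vcenter_sq_idem (%C e + %C f - (%C e * %C f + %C e * %C f))).
have := boolring_sq e; have := boolring_sq f.
move: (%C e) (%C f) => a b bb aa.
have -> : (a + b - (a * b + a * b)) * (a + b - (a * b + a * b)) =
  a * a + b * b + 2%:R * (a * b) - 4%:R * (a * a * b)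
  - 4%:R * (a * (b * b)) + 4%:R * (a * a * (b * b)) by ring.
by rewrite aa bb; ring.
Qed.

Definition boolring_zero := boolring_mk boolring0_subproof.
Definition boolring_one := boolring_mk boolring1_subproof.
Definition boolring_mul e f := boolring_mk (boolringM_subproof e f).
Definition boolring_add e f := boolring_mk (boolringD_subproof e f).

Let mulE e f : %C (boolring_mul e f) = %C e * %C f.
Proof. exact: val_inj. Qed.
Let addE e f : %C (boolring_add e f) = %C e + %C f - 2%:R * (%C e * %C f).
Proof. by apply: val_inj; rewrite mulr_natl mulr2n. Qed.
Let zeroE : %C boolring_zero = 0.
Proof. exact: val_inj. Qed.
Let oneE : %C boolring_one = 1.
Proof. exact: val_inj. Qed.

Lemma boolring_addA : associative boolring_add.
Proof. by move=> e f g; apply: boolring_vcenter_inj; rewrite !addE; ring. Qed.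
Lemma boolring_addC : commutative boolring_add.
Proof. by move=> e f; apply: boolring_vcenter_inj; rewrite !addE; ring. Qed.
Lemma boolring_add0 : left_id boolring_zero boolring_add.
Proof. by move=> e; apply: boolring_vcenter_inj; rewrite addE zeroE; ring. Qed.
Lemma boolring_addN : left_inverse boolring_zero id boolring_add.
Proof.
move=> e; apply: boolring_vcenter_inj.
by rewrite addE zeroE boolring_sq; ring.
Qed.
HB.instance Definition _ := GRing.isZmodule.Build (boolring V)
  boolring_addA boolring_addC boolring_add0 boolring_addN.

Lemma boolring_mulA : associative boolring_mul.
Proof. by move=> e f g; apply: boolring_vcenter_inj; rewrite !mulE mulrA. Qed.
Lemma boolring_mulC : commutative boolring_mul.
Proof. by move=> e f; apply: boolring_vcenter_inj; rewrite !mulE mulrC. Qed.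
Lemma boolring_mul1 : left_id boolring_one boolring_mul.
Proof. by move=> e; apply: boolring_vcenter_inj; rewrite mulE oneE mul1r. Qed.
Lemma boolring_mulDl : left_distributive boolring_mul boolring_add.
Proof.
move=> e f g; apply: boolring_vcenter_inj; rewrite !(addE, mulE).
have := boolring_sq g; move: (%C e) (%C f) (%C g) => a b c cc.
have -> : a * c + b * c - 2%:R * (a * c * (b * c)) =
  a * c + b * c - 2%:R * (a * b * (c * c)) by ring.
by rewrite cc; ring.
Qed.
HB.instance Definition _ := GRing.Zmodule_isComPzRing.Build (boolring V)
  boolring_mulA boolring_mulC boolring_mul1 boolring_mulDl.

Lemma val_boolring0 : val (0 : boolring V) = 0.
Proof. by []. Qed.
Lemma val_boolring1 : val (1 : boolring V) = vac.
Proof. by []. Qed.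
Lemma val_boolringM e f : val (e * f) = val e *_[-1] val f.
Proof. by []. Qed.
Lemma val_boolringD e f :
  val (e + f) = val e + val f - (val e *_[-1] val f) *+ 2.
Proof. by []. Qed.
Lemma boolring_oppE e : - e = e.
Proof. by []. Qed.
Lemma boolring_mulrr e : e * e = e.
Proof. exact/val_inj/(boolring_idem e (-1)). Qed.

End BooleanRing.

Definition prime_ideal (R : comPzRingType) (I : set R) : Prop :=
  [/\ I 0, (forall a b, I a -> I b -> I (a + b)),
      (forall a b, I b -> I (a * b)), ~ I 1 &
      forall a b, I (a * b) -> I a \/ I b].

Record spec (R : comPzRingType) :=
  Spec { spec_set :> set R; spec_prime : prime_ideal spec_set }.

Section Spec.
Variable R : comPzRingType.
Implicit Types (M : spec R) (a b : R).

HB.instance Definition _ := gen_eqMixin (spec R).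
HB.instance Definition _ := gen_choiceMixin (spec R).

Definition basic_open a : set (spec R) := [set M | ~ (M : set R) a].

Lemma basic_open1 : basic_open 1 = setT.
Proof. by apply/seteqP; split=> // M _; case: (spec_prime M). Qed.

Lemma basic_openM a b : basic_open (a * b) = basic_open a `&` basic_open b.
Proof.
apply/seteqP; split=> M; case: (spec_prime M) => M0 MD MM M1 MP.
  by move=> nMab; split=> [Ma|Mb]; apply: nMab; [rewrite mulrC|]; apply: MM.
by move=> [nMa nMb] /MP [].
Qed.

Lemma spec_cover : \bigcup_(A in range basic_open) A = [set: spec R].
Proof.
apply/seteqP; split=> // M _; exists setT => //.
by exists 1 => //; exact: basic_open1.
Qed.

Lemma spec_join (A B : set (spec R)) M :
  range basic_open A -> range basic_open B -> A M -> B M ->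
  exists C, [/\ range basic_open C, C M & C `<=` A `&` B].
Proof.
move=> [a _ <-] [b _ <-] Ma Mb; exists (basic_open (a * b)).
by split; [exists (a * b)|rewrite basic_openM|rewrite basic_openM].
Qed.

HB.instance Definition _ :=
  @isBaseTopological.Build (spec R) (set (spec R)) (range basic_open) id
    spec_cover spec_join.

End Spec.

Record vertex_ideal (V : vertexRingType) (I : set V) : Prop := VertexIdeal {
  videal0 : I 0;
  videalB : forall u v, I u -> I v -> I (u - v);
  videal_mull : forall n a u, I u -> I (a *_[n] u);
  videal_mulr : forall n a u, I u -> I (u *_[n] a)
}.

Record videal (V : vertexRingType) :=
  VIdeal { videal_set :> set V; videalP : vertex_ideal videal_set }.

Definition videal_pred (V : vertexRingType) (I : videal V) : {pred V} :=
  fun u => `[< videal_set I u >].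

Section VertexQuotient.
Local Open Scope quotient_scope.
Variables (V : vertexRingType) (I : videal V).

Lemma videal_zmod_closed : zmod_closed (videal_pred I).
Proof.
split; first exact/asboolP/(videal0 (videalP I)).
by move=> u v /asboolP Iu /asboolP Iv; apply/asboolP/(videalB (videalP I)).
Qed.

HB.instance Definition _ :=
  GRing.isZmodClosed.Build V (videal_pred I) videal_zmod_closed.

Definition vquot : Type := Quotient.quot (videal_pred I).
HB.instance Definition _ := GRing.Zmodule.on vquot.

Definition vpi (v : V) : vquot := \pi_(Quotient.quot (videal_pred I)) v.

Lemma vpi_eq u v : vpi u = vpi v <-> (I : set V) (u - v).
Proof.
split=> [/eqP|Iuv].
  by rewrite -Quotient.idealrBE => /asboolP.
by apply/eqP; rewrite -Quotient.idealrBE; apply/asboolP.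
Qed.

Lemma vpi_surj (x : vquot) : exists v, vpi v = x.
Proof. by exists (repr x); exact: reprK. Qed.

Lemma vpi0 : vpi 0 = 0.
Proof. exact: raddf0. Qed.
Lemma vpiN u : vpi (- u) = - vpi u.
Proof. exact: raddfN. Qed.
Lemma vpiD u v : vpi (u + v) = vpi u + vpi v.
Proof. exact: raddfD. Qed.
Lemma vpiB u v : vpi (u - v) = vpi u - vpi v.
Proof. exact: raddfB. Qed.
Lemma vpiMz u (k : int) : vpi (u *~ k) = vpi u *~ k.
Proof. exact: raddfMz. Qed.

Definition vquot_mul (n : int) (x y : vquot) : vquot := vpi (repr x *_[n] repr y).
Definition vquot_vac : vquot := vpi vac.

Lemma vpi_repr (x : vquot) : vpi (repr x) = x.
Proof. exact: reprK. Qed.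

Lemma vpi_mul n u v : vquot_mul n (vpi u) (vpi v) = vpi (u *_[n] v).
Proof.
apply/vpi_eq; set u' := repr _; set v' := repr _.
have -> : u' *_[n] v' - u *_[n] v = (u' - u) *_[n] v' - u *_[n] (v - v').
  by rewrite vmulBl vmulBr opprB addrA subrK.
apply: (videalB (videalP I)).
  by apply: (videal_mulr (videalP I)); apply/vpi_eq; rewrite vpi_repr.
by apply: (videal_mull (videalP I)); apply/vpi_eq; rewrite vpi_repr.
Qed.

Lemma vquot_mulDl n y : {morph (fun x => vquot_mul n x y) : a b / a + b}.
Proof.
move=> a b /=; rewrite -[a]vpi_repr -[b]vpi_repr -[y]vpi_repr.
by rewrite -vpiD !vpi_mul vmulDl vpiD.
Qed.

Lemma vquot_mulDr n x : {morph (fun y => vquot_mul n x y) : a b / a + b}.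
Proof.
move=> a b /=; rewrite -[a]vpi_repr -[b]vpi_repr -[x]vpi_repr.
by rewrite -vpiD !vpi_mul vmulDr vpiD.
Qed.

Lemma vquot_mul_trunc x y : exists n0 : nat,
  forall n : int, n0%:Z <= n -> vquot_mul n x y = 0.
Proof.
have [n0 n0P] := vmul_trunc (repr x) (repr y).
by exists n0 => n /n0P; rewrite /vquot_mul => ->; exact: vpi0.
Qed.

Lemma vquot_mulv1 x : vquot_mul (-1) x vquot_vac = x.
Proof. by rewrite -[x]vpi_repr vpi_mul vmulv1. Qed.

Lemma vquot_mul_vac_ge0 x (n : int) : 0 <= n -> vquot_mul n x vquot_vac = 0.
Proof. by move=> n0; rewrite -[x]vpi_repr vpi_mul vmul_vac_ge0 // vpi0. Qed.

Lemma vpi_fsum (N : nat) (F : nat -> V) :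
  (forall i, (N <= i)%N -> F i = 0) ->
  vpi (\sum_(i \in [set: nat]) F i) = \sum_(i \in [set: nat]) vpi (F i).
Proof.
move=> F0; rewrite (fsum_nat F0) (fsum_nat (N := N)) => [|i /F0 ->].
  exact: raddf_sum.
exact: vpi0.
Qed.

Lemma vquot_borcherds x y z (r s t : int) :
  \sum_(i \in [set: nat])
    vquot_mul (r + s - i%:Z) (vquot_mul (t + i%:Z) x y) z *~ binz r i =
  \sum_(i \in [set: nat])
    (vquot_mul (r + t - i%:Z) x (vquot_mul (s + i%:Z) y z)
      - vquot_mul (s + t - i%:Z) y (vquot_mul (r + i%:Z) x z) *~ ((-1) ^ t))
    *~ ((-1) ^+ i * binz t i).
Proof.
rewrite -[x]vpi_repr -[y]vpi_repr -[z]vpi_repr.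
move: (repr x) (repr y) (repr z) => u v w.
have [n1 n1P] := vmul_trunc u v.
have [n2 n2P] := vmul_trunc v w.
have [n3 n3P] := vmul_trunc u w.
have := congr1 vpi (borcherds u v w r s t).
rewrite (vpi_fsum (N := (n1 + `|t|)%N)) => [|i le_i]; last first.
  by rewrite n1P ?vmul0l ?mul0rz //; lia.
rewrite (vpi_fsum (N := (n2 + `|s| + n3 + `|r|)%N)) => [|i le_i]; last first.
  rewrite n2P; last lia.
  rewrite n3P; last lia.
  by rewrite !vmul0r mul0rz subr0 mul0rz.
move=> eqV; under eq_fsbigr do rewrite !vpi_mul -vpiMz.
rewrite eqV; apply: eq_fsbigr => i _.
by rewrite !vpi_mul vpiMz vpiB vpiMz.
Qed.

HB.instance Definition _ := Zmodule_isVertexRing.Build vquot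
  vquot_mulDl vquot_mulDr vquot_mul_trunc vquot_mulv1 vquot_mul_vac_ge0
  vquot_borcherds.

Lemma vpi_vmul n u v : vpi (u *_[n] v) = vpi u *_[n] vpi v.
Proof. by rewrite -vpi_mul. Qed.

Lemma vpi_vac : vpi vac = vac.
Proof. by []. Qed.

End VertexQuotient.

Definition stone (V : vertexRingType) : Type := spec (boolring V).
HB.instance Definition _ V := Topological.on (stone V).

Section PierceBundle.
Variable V : vertexRingType.
Implicit Types (M : stone V) (e f g : boolring V) (u v w : V).

Definition pierce_set M : set V :=
  \bigcup_(e in spec_set M) range (vmul (-1) (val e)).

Lemma pierce_setP M u :
  pierce_set M u <-> exists2 e, spec_set M e & val e *_[-1] u = u.
Proof.
split=> [[e Me [v _ <-]]|[e Me eu]]; last by exists e => //; exists u.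
exists e => //; rewrite -centerA; last exact: boolring_center.
by rewrite -val_boolringM boolring_mulrr.
Qed.

Lemma pierce_set_ideal M : vertex_ideal (pierce_set M).
Proof.
have [M0 MD MM M1 MP] := spec_prime M; split.
- by exists 0 => //; exists 0; rewrite ?vmul0r.
- move=> u v /pierce_setP[e Me eu] /pierce_setP[f Mf fv].
  have eC := boolring_center e; have fC := boolring_center f.
  apply/pierce_setP; exists (e + f + e * f).
    by apply: (MD); [exact: MD|exact: MM].
  have absorb (g h : boolring V) (x : V) : h * g = g -> val g *_[-1] x = x ->
      val h *_[-1] x = x.
    move=> hg gx; rewrite -gx -centerA; last exact: boolring_center.
    by rewrite -val_boolringM hg.
  have ee := boolring_mulrr e; have ff := boolring_mulrr f.
  have efef : e * f + e * f = 0 by rewrite -[X in _ + X]boolring_oppE subrr.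
  have he : (e + f + e * f) * e = e.
    by rewrite !mulrDl ee mulrAC ee (mulrC f) -addrA efef addr0.
  have hf : (e + f + e * f) * f = f.
    by rewrite !mulrDl -mulrA ff addrAC efef add0r.
  by rewrite vmulBr; congr (_ - _); [exact: absorb he eu|exact: absorb hf fv].
- move=> n a u [e Me [v _ <-]]; exists e => //; exists (a *_[n] v) => //.
  by rewrite centerAC //; exact: boolring_center.
move=> n a u [e Me [v _ <-]]; exists e => //; exists (v *_[n] a) => //.
by rewrite centerA //; exact: boolring_center.
Qed.

Definition pierce_ideal M : videal V := VIdeal (pierce_set_ideal M).

Definition pierce_stalk M : vertexRingType := vquot (pierce_ideal M).

Definition pierce_total : Type := {M : stone V & pierce_stalk M}.

Definition pierce_proj (t : pierce_total) : stone V := projT1 t.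

Definition pierce_incl M (x : pierce_stalk M) : pierce_total :=
  existT pierce_stalk M x.

Definition pierce_section v M : pierce_total :=
  pierce_incl (vpi (pierce_ideal M) v).

Definition pierce_base : set (set pierce_total) :=
  [set A | exists v e, A = pierce_section v @` basic_open e].

Lemma pierce_cover : \bigcup_(A in pierce_base) A = [set: pierce_total].
Proof.
apply/seteqP; split=> // -[M x] _; have [v vx] := vpi_surj x.
exists (pierce_section v @` basic_open 1); first by exists v, 1.
by exists M; rewrite ?basic_open1 // /pierce_section /pierce_incl vx.
Qed.

Lemma pierce_incl_inj M : injective (@pierce_incl M).
Proof.
move=> x y xy; have := projT2_eq xy.
by rewrite (Prop_irrelevance (projT1_eq xy) erefl).
Qed.

Lemma pierce_section_eq u v M :
  pierce_section u M = pierce_section v M <-> pierce_set M (u - v).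
Proof.
split=> [/pierce_incl_inj /vpi_eq //|uv].
by congr pierce_incl; apply/vpi_eq.
Qed.

Lemma pierce_join (A B : set pierce_total) t :
  pierce_base A -> pierce_base B -> A t -> B t ->
  exists C, [/\ pierce_base C, C t & C `<=` A `&` B].
Proof.
move=> [u [e ->]] [v [f ->]] [M Me <-] [M' Mf uv].
have MM' : M' = M by exact: (congr1 pierce_proj uv).
move: Mf uv; rewrite MM' => Mf /esym/pierce_section_eq/pierce_setP[g Mg guv].
exists (pierce_section u @` basic_open (e * f * (1 - g))); split.
- by exists u, (e * f * (1 - g)).
- exists M => //; rewrite !basic_openM; split=> // M1g.
  have [_ MD _ M1 _] := spec_prime M; apply: M1.
  by rewrite -(subrK g 1); apply: MD.
move=> _ [N + <-]; rewrite !basic_openM => -[[Ne Nf] N1g].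
split; exists N => //; apply/esym/pierce_section_eq/pierce_setP; exists g => //.
have [N0 _ _ _ NP] := spec_prime N.
have [//|//] : spec_set N g \/ spec_set N (1 - g).
by apply: NP; rewrite mulrBr mulr1 boolring_mulrr subrr.
Qed.

HB.instance Definition _ := gen_eqMixin pierce_total.
HB.instance Definition _ := gen_choiceMixin pierce_total.
HB.instance Definition _ :=
  @isBaseTopological.Build pierce_total (set pierce_total) pierce_base id
    pierce_cover pierce_join.

End PierceBundle.

Section EtaleBundle.
Variables (E X : topologicalType) (p : E -> X).

Definition homeomorphic_on (A : set E) (B : set X) : Prop :=
  exists g : X -> E, [/\ set_bij A B p, {in A, cancel p g},
    {within A, continuous p} & {within B, continuous g}].

Definition local_homeomorphism : Prop := forall t : E, exists U : set E,
  [/\ open U, U t, open (p @` U) & homeomorphic_on U (p @` U)].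

Definition fiber_product : set (E * E) := [set d | p d.1 = p d.2].

(* The vertex ring structure on the stalk over x is given by a vertex ring
   [F x] together with a bijection [j x] of [F x] with p^-1(x). *)
Variables (F : X -> vertexRingType) (j : forall x, F x -> E).

Definition stalk_coord (x : X) (t : E) : F x :=
  'pinv_(fun=> 0) [set: F x] (j (x := x)) t.

(* The operation on the fiber product induced by a family of operations on
   the stalks; its values outside [fiber_product] are irrelevant. *)
Definition stalkwise (op : forall x, F x -> F x -> F x) (d : E * E) : E :=
  let x := p d.1 in j (op x (stalk_coord x d.1) (stalk_coord x d.2)).

Record etale_bundle : Prop := EtaleBundle {
  etale_continuous : continuous p;
  etale_surjective : forall x, exists t, p t = x;
  etale_local_homeo : local_homeomorphism;
  etale_stalk : forall x, set_bij [set: F x] (p @^-1` [set x]) (j (x := x));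
  etale_sub : {within fiber_product,
    continuous (stalkwise (fun x (a b : F x) => a - b))};
  etale_mul : forall n : int, {within fiber_product,
    continuous (stalkwise (fun x (a b : F x) => a *_[n] b))};
  etale_vac : continuous (fun x : X => j (vac : F x))
}.

End EtaleBundle.

(* Main.v *)
(** Two sections sigma_u, sigma_v agree at M iff some idempotent g in M fixes
    u - v, and such a g lies in every M' of the basic open set N(1 - g); so the
    set where two sections agree is open.  Hence every sigma_v is continuous,
    and it inverts the projection on its open image, which gives the local
    homeomorphisms.  Near a point of the fiber product, the stalkwise difference
    and products are sigma_w composed with the projection, for w computed in V. *)
Require Import Defs.
From HB Require Import structures.
From mathcomp Require Import all_boot all_order all_algebra.
From mathcomp Require Import all_classical topology.

Set Implicit Arguments.
Unset Strict Implicit.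
Unset Printing Implicit Defensive.

Import GRing.Theory.
Local Open Scope classical_set_scope.
Local Open Scope ring_scope.

Lemma basic_open_open (R : comPzRingType) (a : R) : open (basic_open a).
Proof. by exists [set basic_open a]; rewrite ?bigcup_set1 // => _ ->; exists a. Qed.

Section PierceBundle.
Variable V : vertexRingType.
Implicit Types (M : stone V) (e : boolring V) (u v : V).

(** A prime contains [e] or [1 - e] because their product is 0, and not both because their sum is 1;
    so each N(e) is clopen. *)
Lemma basic_open_onem e : basic_open (1 - e) = [set M | spec_set M e].
Proof.
apply/seteqP; split=> M; case: (spec_prime M) => M0 MD _ M1 MP /=.
  move=> M1e; have [//|//] : spec_set M e \/ spec_set M (1 - e).
  by apply: MP; rewrite mulrBr mulr1 boolring_mulrr subrr.
by move=> Me M1e; apply: M1; rewrite -(subrK e 1); exact: MD.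
Qed.

(** Whether [e] fixes [u] does not depend on [M], so one such [e] serves every prime containing
    it. *)
Lemma pierce_set_open u : open [set M : stone V | pierce_set M u].
Proof.
have -> : [set M : stone V | pierce_set M u] =
    \bigcup_(e in [set e : boolring V | vmul (-1) (val e) u = u])
      basic_open (1 - e).
  apply/seteqP; split=> M.
    by move=> /pierce_setP[e Me eu]; exists e => //; rewrite basic_open_onem.
  move=> [e eu]; rewrite basic_open_onem => Me.
  by apply/pierce_setP; exists e.
by apply: bigcup_open => e _; exact: basic_open_open.
Qed.

Lemma pierce_section_image_open v e :
  open (pierce_section v @` basic_open e).
Proof.
exists [set pierce_section v @` basic_open e]; last by rewrite bigcup_set1.
by move=> _ ->; exists v, e.
Qed.

Lemma pierce_section_continuous v :
  continuous (pierce_section v : stone V -> pierce_total V).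
Proof.
apply/continuousP => _ [D DB <-]; rewrite preimage_bigcup.
apply: bigcup_open => A /DB [u [e ->]].
(* The preimage of the sheet of [u] over N(e) is the part of N(e) where the two sections agree. *)
have -> : pierce_section v @^-1` (pierce_section u @` basic_open e) =
    basic_open e `&` [set M : stone V | pierce_set M (u - v)].
  apply/seteqP; split=> M /=; last first.
    by move=> [Me uv]; exists M => //; apply/pierce_section_eq.
  move=> [N Ne uv]; have NM : N = M by exact: (congr1 (@pierce_proj V) uv).
  by rewrite NM in Ne uv; split=> //; apply/pierce_section_eq.
by apply: openI; [exact: basic_open_open|exact: pierce_set_open].
Qed.

Lemma pierce_sectionP (t : pierce_total V) :
  exists v, t = pierce_section v (pierce_proj t).
Proof.
by case: t => M x; have [v <-] := vpi_surj x; exists v.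
Qed.

Lemma pierce_proj_continuous : continuous (@pierce_proj V).
Proof.
apply/continuousP => _ [D DB <-]; rewrite preimage_bigcup.
apply: bigcup_open => A /DB [e _ <-].
(* Every point lies on some section, so the sheets over N(e) fill its whole preimage. *)
have -> : @pierce_proj V @^-1` basic_open e =
    \bigcup_(v in setT) (pierce_section v @` basic_open e).
  apply/seteqP; split=> [t te|t [v _ [M Me <-]] //].
  have [v tv] := pierce_sectionP t.
  by exists v => //; exists (pierce_proj t).
by apply: bigcup_open => v _; exact: pierce_section_image_open.
Qed.

Lemma stalk_coord_incl M (x : pierce_stalk M) :
  stalk_coord (@pierce_incl V) M (pierce_incl x) = x.
Proof. by rewrite /stalk_coord pinvKV ?in_setE // => a b _ _ /pierce_incl_inj. Qed.

(** Treats the difference and all the products at once: [opV] is an operation on [V] that induces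
    [op] on every stalk. *)
Lemma stalkwise_continuous (op : forall M, pierce_stalk M -> pierce_stalk M ->
    pierce_stalk M) (opV : V -> V -> V) :
  (forall M u v, vpi (pierce_ideal M) (opV u v) =
    op M (vpi (pierce_ideal M) u) (vpi (pierce_ideal M) v)) ->
  {within fiber_product (@pierce_proj V),
    continuous (stalkwise (@pierce_proj V) (@pierce_incl V) op)}.
Proof.
move=> opE; apply/subspace_continuousP => -[t1 t2] /= t12.
have [u t1u] := pierce_sectionP t1; have [v t2v] := pierce_sectionP t2.
(* Since N(1) is the whole space, [S w] is the full image of the section of [w]. *)
pose S w : set (pierce_total V) := pierce_section w @` basic_open 1.
have S_nbhs w t : t = pierce_section w (pierce_proj t) -> nbhs t (S w).
  move=> tw; apply: open_nbhs_nbhs; split; first exact: pierce_section_image_open.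
  by rewrite tw; exists (pierce_proj t); rewrite ?basic_open1.
pose G (d : pierce_total V * pierce_total V) :=
  pierce_section (opV u v) (pierce_proj d.1).
have opG d : fiber_product (@pierce_proj V) d -> S u d.1 -> S v d.2 ->
    stalkwise (@pierce_proj V) (@pierce_incl V) op d = G d.
  case: d => s1 s2 /= sF [M _ Ms] [N _ Ns]; move: sF; rewrite -{}Ms -{}Ns.
  (* Both points must sit over the same [M] before their coordinates can be computed in one
     stalk. *)
  rewrite /fiber_product /= => MN; have {MN}<- : M = N by [].
  rewrite /stalkwise /G /=.
  by rewrite /pierce_section !stalk_coord_incl opE.
rewrite /from_subspace opG //=; last exact: nbhs_singleton (S_nbhs _ _ t2v).
  2: exact: nbhs_singleton (S_nbhs _ _ t1u).
have cG : G d @[d --> (t1, t2)] --> G (t1, t2).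
  apply: (@continuous_comp _ _ _ (fun d => pierce_proj d.1)
    (pierce_section (opV u v))).
    by apply: continuous_comp; [exact: cvg_fst|exact: pierce_proj_continuous].
  exact: pierce_section_continuous.
(* [G] is continuous on the whole product, while [stalkwise] agrees with it only near the point and
   inside the fiber product. *)
apply: cvg_trans (cvg_within_filter _ cG).
apply: near_eq_cvg; rewrite near_withinE; near=> d => dF.
apply/esym/opG => //.
  near: d; exact: cvg_fst (S_nbhs _ _ t1u).
near: d; exact: cvg_snd (S_nbhs _ _ t2v).
Unshelve. all: by end_near. Qed.

Lemma pierce_local_homeomorphism : local_homeomorphism (@pierce_proj V).
Proof.
move=> t; have [v tv] := pierce_sectionP t.
(* Sections are global, so the sheet through [t] can be taken over all of the Stone space. *)
exists (pierce_section v @` basic_open 1).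
have projU : @pierce_proj V @` (pierce_section v @` basic_open 1) = setT.
  apply/seteqP; split=> // M _; exists (pierce_section v M) => //.
  by exists M; rewrite ?basic_open1.
split; rewrite ?projU.
- exact: pierce_section_image_open.
- by rewrite tv; exists (pierce_proj t); rewrite ?basic_open1.
- exact: openT.
exists (pierce_section v); split.
- split=> //.
    by move=> _ _ /set_mem[M _ <-] /set_mem[N _ <-] /= MN; congr pierce_section.
  by rewrite /set_surj projU.
- by move=> _ /set_mem[M _ <-].
- exact/continuous_subspaceT/pierce_proj_continuous.
exact/continuous_subspaceT/pierce_section_continuous.
Qed.

End PierceBundle.

Theorem theorem9p5 (V : vertexRingType) :
  etale_bundle (E := pierce_total V) (X := stone V)
    (@pierce_proj V) (F := @pierce_stalk V) (@pierce_incl V).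
Proof.
split.
- exact: pierce_proj_continuous.
- by move=> M; exists (pierce_section 0 M).
- exact: pierce_local_homeomorphism.
- move=> M; split=> //; first by move=> x y _ _ /pierce_incl_inj.
  by case=> N x /= NM; subst; exists x.
- by apply: stalkwise_continuous => M u v; exact: vpiB.
- by move=> n; apply: stalkwise_continuous => M u v; exact: vpi_vmul.
(* The vacuum of each stalk is by definition the class of [vac], so this map is the section of
   [vac]. *)
exact: pierce_section_continuous.
Qed.
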